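(* Suppose that the sequence $\{\boldsymbol{\alpha}^j\}$ generated by PASSCoDe-Wild converges to $\hat{\boldsymbol{\alpha}}\in\mathbb{R}^n$ and that the sequence $\{\hat{\boldsymbol{w}}^j\}$ of primal vectors maintained in shared memory converges to $\hat{\boldsymbol{w}}\in\mathbb{R}^d$. Put $\boldsymbol{\epsilon}=\sum_{i=1}^n\hat\alpha_i\boldsymbol{x}_i-\hat{\boldsymbol{w}}$. Then $\hat{\boldsymbol{w}}$ is the solution of the perturbed primal problem $$\hat{\boldsymbol{w}}=\arg\min_{\boldsymbol{w}\in\mathbb{R}^d}\ \tfrac12(\boldsymbol{w}+\boldsymbol{\epsilon})^T(\boldsymbol{w}+\boldsymbol{\epsilon})+\sum_{i=1}^n\ell_i(\boldsymbol{w}^T\boldsymbol{x}_i).$$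
   Context: Let $\boldsymbol{x}_1,\dots,\boldsymbol{x}_n\in\mathbb{R}^d$ be nonzero and let $\ell_i:\mathbb{R}\to\mathbb{R}$ be convex loss functions with conjugates $\ell_i^*(u)=\sup_z(zu-\ell_i(z))$. PASSCoDe-Wild (model). At each step $j=0,1,2,\dots$ an index $i(j)\in\{1,\dots,n\}$ is selected and $$\Delta\alpha_j=\arg\min_\delta\ \tfrac12\|\hat{\boldsymbol{w}}^j+\delta\boldsymbol{x}_{i(j)}\|^2+\ell^*_{i(j)}\big(-(\alpha^j_{i(j)}+\delta)\big),\qquad \alpha^{j+1}_{i(j)}=\alpha^j_{i(j)}+\Delta\alpha_j,\qquad \alpha^{j+1}_t=\alpha^j_t\ (t\neq i(j)),$$ where $\hat{\boldsymbol{w}}^j\in\mathbb{R}^d$ is the vector currently in shared memory. Since the writes $\boldsymbol{w}\leftarrow\boldsymbol{w}+\Delta\alpha_j\boldsymbol{x}_{i(j)}$ are done without locks or atomic operations, some may be lost, so no relation between $\hat{\boldsymbol{w}}^j$ and $\sum_i\alpha_i^j\boldsymbol{x}_i$ is assumed. Indices are sampled at random so that every $i\in\{1,\dots,n\}$ is selected infinitely often (this holds almost surely under uniform random sampling). *)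

(* Defs.v *)
From HB Require Import structures.
From mathcomp Require Export all_boot all_order all_algebra.
From mathcomp Require Export all_classical all_reals all_analysis.
Export Order.TTheory GRing.Theory Num.Theory.
Export numFieldNormedType.Exports.

Global Set Implicit Arguments.
Global Unset Strict Implicit.
Global Unset Printing Implicit Defensive.

Global Open Scope classical_set_scope.
Global Open Scope ring_scope.

Definition dot (R : realType) (d : nat) (u v : 'cV[R]_d) : R := (u^T *m v) 0 0.

(* Not [`|u|], which on matrices is the sup norm. *)
Definition norm2 (R : realType) (d : nat) (u : 'cV[R]_d) : R :=
  Num.sqrt (dot u u).

Definition conjugate (R : realType) (f : R -> R) (u : R) : \bar R :=
  ereal_sup [set (z * u - f z)%:E | z in [set: R]].

Definition argmin (disp : Order.disp_t) (V : porderType disp) (T : Type)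
    (F : T -> V) : set T :=
  [set t | forall s, (F t <= F s)%O].

Definition coord_objective (R : realType) (d : nat) (l : R -> R)
    (x w : 'cV[R]_d) (a delta : R) : \bar R :=
  ((2^-1 * norm2 (w + delta *: x) ^+ 2)%:E + conjugate l (- (a + delta)))%E.

(* [i j] is the index chosen at step [j], [what j] the content of the shared
   memory at that step and [dalpha j] the dual increment.  Writes to the shared
   memory may be lost, so [what] is not tied to [alpha].  As [x t != 0], the
   objective is strictly convex in the increment, so [argmin] has at most one
   element and membership determines [dalpha j]. *)
Record passcode_wild (R : realType) (n d : nat) (x : 'I_n -> 'cV[R]_d)
    (l : 'I_n -> R -> R) (i : nat -> 'I_n) (alpha : nat -> 'cV[R]_n)
    (what : nat -> 'cV[R]_d) (dalpha : nat -> R) : Prop := PasscodeWild {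
  pw_increment : forall j,
    argmin (coord_objective (l (i j)) (x (i j)) (what j) (alpha j (i j) 0))
      (dalpha j) ;
  pw_update : forall j, alpha j.+1 (i j) 0 = alpha j (i j) 0 + dalpha j ;
  pw_frame : forall j t, t != i j -> alpha j.+1 t 0 = alpha j t 0
}.

Definition perturbed_primal (R : realType) (n d : nat) (x : 'I_n -> 'cV[R]_d)
    (l : 'I_n -> R -> R) (eps w : 'cV[R]_d) : R :=
  2^-1 * dot (w + eps) (w + eps) + \sum_(t < n) l t (dot w (x t)).

(* Main.v *)
Require Import Defs.
From mathcomp Require Import ring lra.

(**
The optimality condition of a coordinate step says that [- alpha_i^(j+1)] is a
subgradient of [l_i] at [<what^j + dalpha_j x_i, x_i>].  Each index occurs
infinitely often and [dalpha_j] tends to 0, so in the limit [- alphahat_i] is a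
subgradient of [l_i] at [<w, x_i>].  As [w + eps = \sum_i alphahat_i x_i], adding
up the subgradient inequalities shows that the perturbed objective at [s]
exceeds its value at [w] by at least [|s - w|^2 / 2].
*)

Definition subgradient (R : realType) (f : R -> R) (y p : R) : Prop :=
  forall z, f y + p * (z - y) <= f z.

Section Convex.
Variables (R : realType) (f : R -> R).
Hypothesis f_convex : convex_function [set: R^o] f.

Lemma convex_function_le (t a b : R) : 0 <= t <= 1 ->
  f (t * a + (1 - t) * b) <= t * f a + (1 - t) * f b.
Proof.
move=> t01; have := f_convex (Itv01 (andP t01).1 (andP t01).2).
by move=> /(_ a b); rewrite !inE => /(_ I I).
Qed.

Lemma convex_three_points (a y b : R) : a < y -> y < b ->
  (b - a) * f y <= (b - y) * f a + (y - a) * f b.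
Proof.
move=> ay yb; have ab : 0 < b - a by lra.
have t01 : 0 <= (b - y) / (b - a) <= 1.
  by rewrite divr_ge0 ?ler_pdivrMr //=; lra.
have := convex_function_le a b t01.
have -> : (b - y) / (b - a) * a + (1 - (b - y) / (b - a)) * b = y.
  by field; lra.
rewrite -(ler_pM2l ab) => /le_trans; apply.
by rewrite le_eqVlt; apply/orP; left; apply/eqP; field; lra.
Qed.

(** By the three-point inequality every slope to the left of [y] is at most every slope to its
    right. The supremum of the left slopes separates the two families. *)
Lemma convex_has_subgradient (y : R) : exists p, subgradient f y p.
Proof.
pose E := [set (f y - f z) / (y - z) | z in [set z | z < y]].
have E_ub b : y < b -> ubound E ((f b - f y) / (b - y)).
  move=> yb _ [z /= zy <-]; rewrite ler_pdivrMr ?subr_gt0 // mulrAC.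
  rewrite ler_pdivlMr ?subr_gt0 //.
  by have := convex_three_points zy yb; lra.
have E_neq0 : E !=set0.
  by exists ((f y - f (y - 1)) / (y - (y - 1))), (y - 1) => //=; lra.
exists (sup E) => z; case: (ltgtP z y) => [zy|yz|->].
- have : (f y - f z) / (y - z) <= sup E.
    apply: sup_upper_bound; last by exists z.
    by split=> //; exists ((f (y + 1) - f y) / (y + 1 - y)); apply: E_ub; lra.
  rewrite ler_pdivrMr ?subr_gt0 //; lra.
- have : sup E <= (f z - f y) / (z - y) by apply: sup_le_ub => //; exact: E_ub.
  rewrite ler_pdivlMr ?subr_gt0 //; lra.
- by rewrite subrr mulr0 addr0.
Qed.

End Convex.

(** Infinitely many [j] suffice, which matters because a given coordinate is updated only at some of
    the steps. *)
Lemma subgradient_closed (R : realType) (f : R -> R) (y p : R)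
    (ys ps : nat -> R) :
    convex_function [set: R^o] f -> ys @ \oo --> y -> ps @ \oo --> p ->
    (forall N, exists2 j, (N <= j)%N & subgradient f (ys j) (ps j)) ->
  subgradient f y p.
Proof.
move=> f_convex ys_y ps_p often z; have [u fu] := convex_has_subgradient f_convex y.
rewrite leNgt; apply/negP => fz.
(* [f y + u * (ys j - y) <= f (ys j)] stands in for the continuity of [f]. *)
have cv : (f y + u * (ys j - y) + ps j * (z - ys j)) @[j --> \oo] -->
    f y + u * (y - y) + p * (z - y).
  apply: cvgD; last by apply: cvgM => //; apply: cvgB => //; exact: cvg_cst.
  apply: cvgD; first exact: cvg_cst.
  by apply: cvgM; [exact: cvg_cst | apply: cvgB => //; exact: cvg_cst].
rewrite subrr mulr0 addr0 in cv.
have [N _ fN] := cvgr_gt _ cv _ fz.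
have [j Nj sj] := often N.
have := fN j Nj; have := sj z; have := fu (ys j) => /=; lra.
Qed.

Section Dot.
Variables (R : realType) (d : nat).
Implicit Types u v w : 'cV[R]_d.

Lemma dotE u v : dot u v = \sum_k u k 0 * v k 0.
Proof. by rewrite /dot mxE; apply: eq_bigr => k _; rewrite mxE. Qed.

Lemma dotC u v : dot u v = dot v u.
Proof. by rewrite !dotE; apply: eq_bigr => k _; rewrite mulrC. Qed.

Lemma dotDl u v w : dot (u + v) w = dot u w + dot v w.
Proof. by rewrite /dot linearD mulmxDl mxE. Qed.

Lemma dotZl a u w : dot (a *: u) w = a * dot u w.
Proof. by rewrite /dot linearZ -scalemxAl mxE. Qed.

Lemma dotDr u v w : dot w (u + v) = dot w u + dot w v.
Proof. by rewrite !(dotC w) dotDl. Qed.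

Lemma dotZr a u w : dot w (a *: u) = a * dot w u.
Proof. by rewrite !(dotC w) dotZl. Qed.

Lemma dotBl u v w : dot (u - v) w = dot u w - dot v w.
Proof. by rewrite dotDl -scaleN1r dotZl mulN1r. Qed.

Lemma dot_suml (I : finType) (u : I -> 'cV[R]_d) w :
  dot (\sum_t u t) w = \sum_t dot (u t) w.
Proof. by rewrite /dot linear_sum mulmx_suml summxE. Qed.

Lemma dot_ge0 u : 0 <= dot u u.
Proof. by rewrite dotE sumr_ge0 // => k _; rewrite -expr2 sqr_ge0. Qed.

Lemma dot_eq0 u : dot u u = 0 -> u = 0.
Proof.
rewrite dotE => /eqP; rewrite psumr_eq0 => [|k _]; last by rewrite -expr2 sqr_ge0.
move=> /allP u0; apply/colP => k; rewrite mxE; apply/eqP.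
by have := u0 k (mem_index_enum k); rewrite mulf_eq0 orbb.
Qed.

Lemma norm2_sqr u : norm2 u ^+ 2 = dot u u.
Proof. by rewrite /norm2 sqr_sqrtr // dot_ge0. Qed.

Lemma cvg_col_entry (us : nat -> 'cV[R]_d) u k :
  us @ \oo --> u -> us j k 0 @[j --> \oo] --> u k 0.
Proof.
move=> us_u; apply: (cvg_comp us (fun M : 'cV[R]_d => M k 0) us_u).
exact: coord_continuous.
Qed.

Lemma cvg_dotl (us : nat -> 'cV[R]_d) u v :
  us @ \oo --> u -> dot (us j) v @[j --> \oo] --> dot u v.
Proof.
move=> us_u; rewrite dotE; under eq_fun do rewrite dotE.
apply: cvg_big => [|k _]; first exact: add_continuous.
apply: cvgM; last exact: cvg_cst.
exact: cvg_col_entry.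
Qed.

End Dot.

Lemma conjugate_ub (R : realType) (f : R -> R) (z u : R) :
  ((z * u - f z)%:E <= conjugate f u)%E.
Proof. by apply: ereal_sup_ubound; exists z. Qed.

Lemma conjugate_le (R : realType) (f : R -> R) (u c : R) :
  (forall z, z * u - f z <= c) -> (conjugate f u <= c%:E)%E.
Proof. by move=> fc; apply: ge_ereal_sup => _ [z _ <-]; rewrite lee_fin. Qed.

Lemma coord_objective_subgradient (R : realType) (d : nat) (f : R -> R)
    (x w : 'cV[R]_d) (a delta : R) :
    convex_function [set: R^o] f ->
    argmin (coord_objective f x w a) delta ->
  subgradient f (dot (w + delta *: x) x) (- (a + delta)).
Proof.
move=> f_convex min_delta; set y := dot _ x; set p := - (a + delta).
have [u fu] := convex_has_subgradient f_convex y.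
pose s := y * u - f y.
(* [s] is the value of the conjugate at [u].  Comparing [delta] with the small
   steps that move [p] towards [u] gives, at first order,
   [conjugate f p <= y * p - f y], which is the equality case of Fenchel-Young.
   This avoids the biconjugate theorem. *)
have conj_u z : z * u - f z <= s by have := fu z; rewrite /s; lra.
have norm_shift h : norm2 (w + (delta + h) *: x) ^+ 2 =
    norm2 (w + delta *: x) ^+ 2 + 2 * h * y + h ^+ 2 * dot x x.
  rewrite !norm2_sqr scalerDl addrA /y; move: (w + delta *: x) => v.
  by rewrite !(dotDl, dotDr, dotZl, dotZr) (dotC x v); ring.
(* Minimality of [delta] against [delta + h]. The real bound [c] keeps the possibly infinite
   [conjugate f (p - h)] out of the arithmetic. *)
have step h c : (conjugate f (p - h) <= c%:E)%E ->
    (conjugate f p <= (h * y + h ^+ 2 * dot x x / 2 + c)%:E)%E.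
  move=> hc; have := min_delta (delta + h).
  rewrite /coord_objective norm_shift.
  have -> : - (a + (delta + h)) = p - h by rewrite /p; ring.
  move=> /le_trans /(_ (leeD2l _ hc)); rewrite -/p -EFinD.
  have := conjugate_ub f 0 p; case: (conjugate f p) => [r| |] //=.
  by rewrite -EFinD !lee_fin; lra.
(* The shift [p - u] leads to [u], where the conjugate is at most [s]; this excludes [+oo]. *)
have [r conj_p] : exists r, conjugate f p = r%:E.
  have := step (p - u) s; rewrite subKr => /(_ (conjugate_le conj_u)).
  have := conjugate_ub f 0 p; case: (conjugate f p) => [r| |] //= _ _.
  by exists r.
have r_ub z : z * p - f z <= r by rewrite -lee_fin -conj_p conjugate_ub.
pose C := (p - u) ^+ 2 * dot x x / 2.
(* Convexity of the conjugate on the segment from [p] to [u], followed by division by [t]. *)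
have slope t : 0 < t -> t < 1 -> r - s <= (p - u) * y + t * C.
  move=> t0 t1; have := step (t * (p - u)) ((1 - t) * r + t * s).
  rewrite conj_p lee_fin => H.
  suff : r <= t * (p - u) * y + (t * (p - u)) ^+ 2 * dot x x / 2
              + ((1 - t) * r + t * s).
    by move=> {H} H; rewrite -(ler_pM2l t0) /C; lra.
  apply: H; apply: conjugate_le => z.
  have := ler_wpM2l (ltW t0) (conj_u z).
  have t'0 : 0 <= 1 - t by lra.
  by have := ler_wpM2l t'0 (r_ub z); lra.
have r_le : r - s <= (p - u) * y.
  have C0 : 0 <= C.
    by apply: divr_ge0 => //; apply: mulr_ge0; [exact: sqr_ge0 | exact: dot_ge0].
  apply/ler_addgt0Pr => e e0.
  (* This [t] makes [t * C <= e]; the summand 1 keeps [t < 1] even if [C = 0]. *)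
  have t0 : 0 < e / (e + C + 1) by rewrite divr_gt0 //; lra.
  have t1 : e / (e + C + 1) < 1 by rewrite ltr_pdivrMr; lra.
  apply: le_trans (slope _ t0 t1) _; rewrite lerD2l mulrAC ler_pdivrMr; last lra.
  by rewrite ler_pM2l //; lra.
(* The auxiliary slope [u] cancels, leaving [z * p - f z <= r <= y * p - f y]. *)
by move=> z; have := r_ub z; move: r_le; rewrite /s; lra.
Qed.

Theorem corollary1 (R : realType) (n d : nat)
    (x : 'I_n -> 'cV[R]_d) (l : 'I_n -> R -> R)
    (i : nat -> 'I_n) (alpha : nat -> 'cV[R]_n) (what : nat -> 'cV[R]_d)
    (dalpha : nat -> R) (alphahat : 'cV[R]_n) (w : 'cV[R]_d)
    (x_neq0 : forall t, x t != 0)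
    (l_convex : forall t, convex_function [set: R^o] (l t))
    (run : passcode_wild x l i alpha what dalpha)
    (i_often : forall (t : 'I_n) (N : nat), exists2 j : nat, (N <= j)%N & i j = t)
    (alpha_cvg : alpha @ \oo --> alphahat)
    (what_cvg : what @ \oo --> w) :
  let eps := \sum_(t < n) alphahat t 0 *: x t - w in
  argmin (perturbed_primal x l eps) = [set w].
Proof.
case: run => increment update _ eps.
have alpha_t t : alpha j t 0 @[j --> \oo] --> alphahat t 0.
  exact: cvg_col_entry.
have alphaS_t t : alpha j.+1 t 0 @[j --> \oo] --> alphahat t 0.
  by have := alpha_t t; rewrite -cvg_shiftS.
have optimal t : subgradient (l t) (dot w (x t)) (- alphahat t 0).
  (* The difference of successive [alpha] entries equals [dalpha j] when [i j = t], and tends to 0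
     along all [j]. *)
  apply: (subgradient_closed (l_convex t)
    (ys := fun j => dot (what j) (x t)
                    + (alpha j.+1 t 0 - alpha j t 0) * dot (x t) (x t))
    (ps := fun j => - alpha j.+1 t 0)).
  - rewrite -[X in _ --> X]addr0 -(mul0r (dot (x t) (x t))).
    rewrite -(subrr (alphahat t 0)).
    apply: cvgD; first exact: cvg_dotl.
    by apply: cvgM; [apply: cvgB | exact: cvg_cst].
  - exact: cvgN.
  - move=> N; have [j Nj ijt] := i_often t N; exists j => //.
    have := coord_objective_subgradient (l_convex _) (increment j).
    rewrite -update dotDl dotZl.
    have -> : dalpha j = alpha j.+1 t 0 - alpha j t 0.
      by rewrite -ijt update addrC addKr.
    by rewrite ijt.
have gap s : perturbed_primal x l eps w + 2^-1 * dot (s - w) (s - w)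
    <= perturbed_primal x l eps s.
  have : \sum_t (l t (dot w (x t)) - alphahat t 0 * dot (s - w) (x t))
      <= \sum_t l t (dot s (x t)).
    by apply: ler_sum => t _; have := optimal t (dot s (x t)); rewrite dotBl; lra.
  rewrite sumrB.
  (* This is the cross term in the expansion of the square at [s + eps], so the two cancel. *)
  have -> : \sum_t alphahat t 0 * dot (s - w) (x t) = dot (w + eps) (s - w).
    have -> : w + eps = \sum_t alphahat t 0 *: x t by rewrite addrC subrK.
    rewrite dot_suml; apply: eq_bigr => t _.
    by rewrite dotZl dotC.
  rewrite /perturbed_primal.
  have -> : s + eps = (w + eps) + (s - w).
    by rewrite [RHS]addrAC [w + _]addrC subrK.
  move: (w + eps) (s - w) => u v.
  rewrite !(dotDl, dotDr) (dotC v u); lra.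
apply/seteqP; split => [s /(_ w) /= ws|s -> v].
  have := gap s; have := dot_ge0 (s - w) => ge0 gap_s.
  apply/eqP; rewrite -subr_eq0; apply/eqP/dot_eq0; lra.
by have := gap v; have := dot_ge0 (v - w); lra.
Qed.
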